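(* Let $R$ be a ring. If $\varinjlim\mathcal P_1=\mathcal F_1$, then $R$ is a right $\mathcal F_1^{\mathrm{fp}}$-coherent ring.
   Context: $R$ is an associative ring with unit and modules are unital. $\mathcal F_1$ (resp. $\mathcal P_1$) is the class of right $R$-modules of flat (resp. projective) dimension at most $1$. For a class $\mathcal C$ of right modules, $\varinjlim\mathcal C$ is the class of all modules that are direct limits of direct systems (over directed sets) of modules in $\mathcal C$. $R$ is right $\mathcal F_1^{\mathrm{fp}}$-coherent if every finitely generated flat right submodule of a free right $R$-module is finitely presented (and thus projective). *)

(* Defs.v *)
From HB Require Import structures.
From mathcomp Require Import all_boot all_order all_algebra.
From mathcomp Require Import boolp.
From mathcomp.multinomials Require Import freeg.
Set Implicit Arguments.
Unset Strict Implicit.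
Unset Printing Implicit Defensive.
Import GRing.Theory.
Local Open Scope ring_scope.
Local Open Scope quotient_scope.

(* A right R-module is a left module over the converse ring R^c: for x in such
   a module and r : R, [(r : R^c) *: x] is the product x r. *)
Notation rmodType R := (lmodType R^c).

(* The tensor product over R of a right and a left module: the free abelian
   group on M x N modulo the subgroup generated by the usual relators. *)
Section Tensor.
Variables (R : pzRingType) (M : rmodType R).

Inductive tensor_relator (N : lmodType R) : {freeg (M * N)%type / int} -> Prop :=
| Relator_addl m m' n :
    tensor_relator (<< (m + m', n) >> - << (m, n) >> - << (m', n) >>)
| Relator_addr m n n' :
    tensor_relator (<< (m, n + n') >> - << (m, n) >> - << (m, n') >>)
| Relator_mid m (r : R) n :
    tensor_relator (<< ((r : R^c) *: m, n) >> - << (m, r *: n) >>).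

Definition tensor_relations (N : lmodType R) : pred {freeg (M * N)%type / int} :=
  fun z => `[< forall K : {pred {freeg (M * N)%type / int}}, zmod_closed K ->
    (forall g, tensor_relator g -> g \in K) -> z \in K >].

Lemma tensor_relations_closed N : zmod_closed (@tensor_relations N).
Proof.
split=> [|x y /asboolP Kx /asboolP Ky]; apply/asboolP => K Kc KR.
  by case: Kc.
by case: (Kc) => _ KB; apply: KB; [exact: Kx | exact: Ky].
Qed.

HB.instance Definition _ N :=
  GRing.isZmodClosed.Build _ (@tensor_relations N) (@tensor_relations_closed N).

Definition tensor (N : lmodType R) : Type :=
  Quotient.quot (GRing.ZmodClosed.clone _ (@tensor_relations N) _).

HB.instance Definition _ N := Choice.on (tensor N).
HB.instance Definition _ N := GRing.Zmodule.on (tensor N).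
HB.instance Definition _ N := ZmodQuotient.on (tensor N).

Definition tens (N : lmodType R) (m : M) (n : N) : tensor N :=
  \pi_(tensor N) << (m, n) >>.

Definition balanced (N : lmodType R) (G : zmodType) (b : M -> N -> G) : Prop :=
  [/\ forall m m' n, b (m + m') n = b m n + b m' n,
      forall m n n', b m (n + n') = b m n + b m n'
    & forall m (r : R) n, b ((r : R^c) *: m) n = b m (r *: n)].

(* The group homomorphism on the free abelian group extending [f]. *)
Definition freeg_lift (K : choiceType) (G : zmodType) (f : K -> G) :
  {freeg K / int} -> G := fglift (f : K -> zmodule G).

(* The map on the tensor product induced by [b]; only meaningful when [b] is
   balanced, in which case it does not depend on the representative chosen. *)
Definition tensor_lift (N : lmodType R) (G : zmodType) (b : M -> N -> G)
    (t : tensor N) : G :=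
  freeg_lift (fun p => b p.1 p.2) (repr t).

Definition tensor_map (A B : lmodType R) (f : A -> B) : tensor A -> tensor B :=
  tensor_lift (fun m a => tens m (f a)).

Lemma freeg_lift_additive K G f : zmod_morphism (@freeg_lift K G f).
Proof. exact: (@lift_is_additive _ K (zmodule G)). Qed.

HB.instance Definition _ K G f :=
  GRing.isZmodMorphism.Build _ _ (@freeg_lift K G f) (@freeg_lift_additive K G f).

Lemma freeg_liftU (K : choiceType) (G : zmodType) (f : K -> G) (x : K) :
  freeg_lift f << x >> = f x.
Proof. by rewrite /freeg_lift liftU scale1r. Qed.

Section Theory.
Variable N : lmodType R.

Lemma tensor_eqP (x y : {freeg (M * N)%type / int}) :
  x = y %[mod (tensor N)] <-> tensor_relations (x - y).
Proof.
have /= E :=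
  Quotient.idealrBE (GRing.ZmodClosed.clone _ (@tensor_relations N) _) x y.
by split=> [/eqP xy|xy]; [exact: etrans E xy | exact/eqP/(etrans (esym E))].
Qed.

Lemma relator_relations g : tensor_relator g -> @tensor_relations N g.
Proof. by move=> gR; apply/asboolP => K _; apply. Qed.

Lemma tens_balanced : balanced (@tens N).
Proof.
have piD (x y : {freeg (M * N)%type / int}) :
  \pi_(tensor N) x + \pi_(tensor N) y = \pi_(tensor N) (x + y).
  exact/esym/pi_addr.
have relP x y : @tensor_relator N (x - y) -> x = y %[mod (tensor N)].
  by move=> xy; apply/tensor_eqP/relator_relations.
split=> [m m' n|m n n'|m r n].
- apply: etrans (esym (piD _ _)); apply: relP.
  rewrite opprD addrA; exact: Relator_addl.
- apply: etrans (esym (piD _ _)); apply: relP.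
  rewrite opprD addrA; exact: Relator_addr.
- by apply: relP; exact: Relator_mid.
Qed.

Lemma tensor_lift_pi (G : zmodType) (b : M -> N -> G) z : balanced b ->
  tensor_lift b (\pi_(tensor N) z) = freeg_lift (fun p => b p.1 p.2) z.
Proof.
case=> bDl bDr bM; set phi := freeg_lift _.
have phiB : zmod_morphism phi by exact: freeg_lift_additive.
have phiU m n : phi << (m, n) >> = b m n by exact: freeg_liftU.
pose K := [pred z | phi z == 0].
have K_closed : zmod_closed K.
  split=> [|x y /eqP Kx /eqP Ky]; apply/eqP; first exact: raddf0.
  by rewrite phiB Kx Ky subrr.
have /asboolP/(_ K K_closed) : tensor_relations (repr (\pi_(tensor N) z) - z).
  by apply/tensor_eqP; rewrite reprK.
have -> : (repr (\pi_(tensor N) z) - z \in K)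
    = (phi (repr (\pi_(tensor N) z)) == phi z) by rewrite -subr_eq0 -phiB.
move=> h; apply/eqP/h => g [m m' n|m n n'|m r n]; apply/eqP;
  rewrite !phiB !phiU.
- by rewrite bDl addrAC addrK subrr.
- by rewrite bDr addrAC addrK subrr.
- by rewrite bM subrr.
Qed.

Lemma tensor_lift_additive (G : zmodType) (b : M -> N -> G) :
  balanced b -> zmod_morphism (tensor_lift b).
Proof.
move=> bb; elim/quotW=> x; elim/quotW=> y.
by rewrite -[_ - _]/(\pi x - \pi y) -(pi_is_zmod_morphism (tensor N)) !tensor_lift_pi // raddfB.
Qed.

Lemma tensor_liftE (G : zmodType) (b : M -> N -> G) m n :
  balanced b -> tensor_lift b (tens m n) = b m n.
Proof. by move=> bb; rewrite tensor_lift_pi // freeg_liftU. Qed.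

Lemma tensor_ext (G : zmodType) (f g : {additive tensor N -> G}) :
  (forall m n, f (tens m n) = g (tens m n)) -> f =1 g.
Proof.
move=> fg; elim/quotW=> z; rewrite -[z]freeg_sumE !raddf_sum.
apply: eq_bigr => -[m n] _.
rewrite -[coeff _ z]intz -freegU_mulz !raddfMz.
by congr (_ *~ _); apply: fg.
Qed.
End Theory.
End Tensor.

Definition flat (R : pzRingType) (M : rmodType R) : Prop :=
  forall (A B : lmodType R) (f : {linear A -> B}),
    injective f -> injective (@tensor_map R M A B f).

(* Left modules over S; right R-modules are the case S = R^c. *)
Section Modules.
Variable S : pzRingType.

Definition surjective (A B : Type) (f : A -> B) : Prop :=
  forall b, exists a, f a = b.

Definition exact_at (A B C : lmodType S) (f : A -> B) (g : B -> C) : Prop :=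
  forall b, g b = 0 <-> exists a, f a = b.

Definition projective (P : lmodType S) : Prop :=
  forall (A B : lmodType S) (g : {linear A -> B}) (f : {linear P -> B}),
    surjective g -> exists h : {linear P -> A}, forall x, g (h x) = f x.

Definition basis (F : lmodType S) (I : choiceType) (e : I -> F) : Prop :=
  (forall (s : seq I) (c : I -> S), uniq s ->
     \sum_(i <- s) c i *: e i = 0 -> forall i, i \in s -> c i = 0) /\
  (forall x, exists (s : seq I) (c : I -> S), x = \sum_(i <- s) c i *: e i).

Definition free_module (F : lmodType S) : Prop :=
  exists (I : choiceType) (e : I -> F), basis e.

Definition finitely_generated (M : lmodType S) : Prop :=
  exists (n : nat) (g : 'I_n -> M),
    forall x, exists c : 'I_n -> S, x = \sum_(i < n) c i *: g i.

Definition finitely_presented (M : lmodType S) : Prop :=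
  exists (m n : nat) (f : {linear 'rV[S]_m -> 'rV[S]_n})
         (p : {linear 'rV[S]_n -> M}), exact_at f p /\ surjective p.

(* Existence of a resolution 0 -> C1 -> C0 -> M -> 0 with C0, C1 in C. *)
Definition resolution_dim_le1 (C : lmodType S -> Prop) (M : lmodType S) : Prop :=
  exists (C1 C0 : lmodType S) (i : {linear C1 -> C0}) (p : {linear C0 -> M}),
    [/\ C C1, C C0, injective i, exact_at i p & surjective p].

Record direct_system := DirectSystem {
  ds_disp : Order.disp_t;
  ds_index : preorderType ds_disp;
  ds_nonempty : inhabited ds_index;
  ds_directed : forall i j : ds_index, exists k, (i <= k)%O /\ (j <= k)%O;
  ds_obj : ds_index -> lmodType S;
  ds_map : forall i j, (i <= j)%O -> {linear ds_obj i -> ds_obj j};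
  ds_map_id : forall i (ii : (i <= i)%O) x, ds_map ii x = x;
  ds_map_comp : forall i j k (ij : (i <= j)%O) (jk : (j <= k)%O) (ik : (i <= k)%O) x,
    ds_map ik x = ds_map jk (ds_map ij x)
}.

Arguments ds_obj : clear implicits.

Definition cocone (D : direct_system) (L : lmodType S)
    (phi : forall i, {linear ds_obj D i -> L}) : Prop :=
  forall i j (ij : (i <= j)%O) x, phi j (ds_map ij x) = phi i x.

Definition is_direct_limit (D : direct_system) (L : lmodType S)
    (phi : forall i, {linear ds_obj D i -> L}) : Prop :=
  cocone phi /\
  forall (N : lmodType S) (psi : forall i, {linear ds_obj D i -> N}), cocone psi ->
    exists h : {linear L -> N}, (forall i x, h (phi i x) = psi i x) /\
      forall h' : {linear L -> N}, (forall i x, h' (phi i x) = psi i x) -> h' =1 h.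

Definition direct_limits (C : lmodType S -> Prop) (M : lmodType S) : Prop :=
  exists (D : direct_system) (phi : forall i, {linear ds_obj D i -> M}),
    (forall i, C (ds_obj D i)) /\ is_direct_limit phi.

End Modules.

Definition class_F1 (R : pzRingType) (M : rmodType R) : Prop :=
  resolution_dim_le1 (@flat R) M.

Definition class_P1 (R : pzRingType) (M : rmodType R) : Prop :=
  resolution_dim_le1 (@projective R^c) M.

Definition right_F1fp_coherent (R : pzRingType) : Prop :=
  forall (F : rmodType R) (P : pred F) (N : subLmodType P),
    free_module F -> finitely_generated N -> flat N -> finitely_presented N.

(* Main.v *)
(* Let N be a finitely generated flat submodule of a free module. It embeds in
   some R^n, and M = R^n / N is finitely presented and lies in F_1, because R^n
   is flat. Hence M is a direct limit of modules M_k in P_1, and since M is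
   finitely presented its identity factors through some M_k. Comparing
   0 -> N -> R^n -> M -> 0 with a projective resolution 0 -> Q1 -> Q0 -> M_k -> 0
   along M -> M_k -> M gives a chain map homotopic to the identity: id_N factors
   through Q1 + R^n. So N is a retract of a projective module, and a finitely
   generated projective module is finitely presented. *)
Require Import Defs.
From HB Require Import structures.
From mathcomp Require Import all_boot all_order all_algebra.
From mathcomp Require Import boolp.
Set Implicit Arguments.
Unset Strict Implicit.
Unset Printing Implicit Defensive.
Import GRing.Theory.
Local Open Scope ring_scope.
Local Open Scope quotient_scope.

(** * Quotient modules *)

Section QuotientModule.
Variables (S : pzRingType) (V : lmodType S) (U : V -> Prop).

Definition submodule : Prop :=
  U 0 /\ forall a x y, U x -> U y -> U (a *: x + y).

Hypothesis sub_U : submodule.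

(* The proof argument is a key for the canonical [zmodClosed] structure. *)
Definition submodule_pred of submodule : pred V := fun x => `[< U x >].
Local Notation P := (submodule_pred sub_U).

Lemma submodule_zmod_closed : zmod_closed P.
Proof.
case: sub_U => U0 UD; split=> [|x y /asboolP Ux /asboolP Uy]; apply/asboolP => //.
by rewrite addrC -scaleN1r; apply: UD.
Qed.

HB.instance Definition _ :=
  GRing.isZmodClosed.Build V P submodule_zmod_closed.

Definition quotient_module : Type :=
  Quotient.quot (GRing.ZmodClosed.clone _ P _).

HB.instance Definition _ := Choice.on quotient_module.
HB.instance Definition _ := GRing.Zmodule.on quotient_module.
HB.instance Definition _ := ZmodQuotient.on quotient_module.

Local Notation Q := quotient_module.

Definition quotient_proj (x : V) : Q := \pi_Q x.
Local Notation p := quotient_proj.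

Lemma quotient_proj_surj : surjective p.
Proof. by move=> x; exists (repr x); exact: reprK. Qed.

Lemma quotient_projP (x y : V) : p x = p y <-> U (x - y).
Proof.
have /= E := Quotient.idealrBE (GRing.ZmodClosed.clone _ P _) x y.
split=> [/eqP xy|xy]; first by apply/asboolP; apply: etrans E xy.
by apply/eqP/(etrans (esym E)); apply/asboolP.
Qed.

Lemma quotient_projD x y : p (x + y) = p x + p y.
Proof. exact: pi_addr. Qed.

(** The choice of representative is harmless: [U] is stable under scaling, which gives
    [quotient_scale_proj]. *)
Definition quotient_scale (a : S) (x : Q) : Q := p (a *: repr x).

Lemma quotient_scale_proj a x : quotient_scale a (p x) = p (a *: x).
Proof.
apply/quotient_projP; rewrite -scalerBr -[a *: _]addr0.
case: (sub_U) => U0; apply=> //.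
apply/quotient_projP; exact: reprK.
Qed.

Fact quotient_scaleA a b x :
  quotient_scale a (quotient_scale b x) = quotient_scale (a * b) x.
Proof.
by case: (quotient_proj_surj x) => {}x <-; rewrite !quotient_scale_proj scalerA.
Qed.

Fact quotient_scale1 : left_id 1 quotient_scale.
Proof.
by move=> x; case: (quotient_proj_surj x) => {}x <-; rewrite quotient_scale_proj scale1r.
Qed.

Fact quotient_scaleDr : right_distributive quotient_scale +%R.
Proof.
move=> a x y; case: (quotient_proj_surj x) (quotient_proj_surj y) => {}x <- [{}y <-].
by rewrite -quotient_projD !quotient_scale_proj -quotient_projD scalerDr.
Qed.

Fact quotient_scaleDl x : {morph quotient_scale^~ x : a b / a + b}.
Proof.
move=> a b; case: (quotient_proj_surj x) => {}x <-.
by rewrite !quotient_scale_proj -quotient_projD scalerDl.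
Qed.

HB.instance Definition _ := GRing.Zmodule_isLmodule.Build S Q
  quotient_scaleA quotient_scale1 quotient_scaleDr quotient_scaleDl.

Fact quotient_proj_linear : linear p.
Proof. by move=> a x y; rewrite quotient_projD -quotient_scale_proj. Qed.

HB.instance Definition _ :=
  GRing.isLinear.Build S V Q *:%R p quotient_proj_linear.

Lemma quotient_proj_eq0 x : p x = 0 <-> U x.
Proof. by rewrite -(linear0 p) quotient_projP subr0. Qed.

End QuotientModule.

(** * Products of modules *)

Section ProductModule.
Variables (S : pzRingType) (I : Type) (V : I -> lmodType S).

Definition product_module : Type := forall i, V i.
Local Notation P := product_module.
HB.instance Definition _ := Choice.on P.

Implicit Types f g h : P.

Let zero : P := fun=> 0.
Let opp f : P := fun i => - f i.
Let add f g : P := fun i => f i + g i.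
Let scale (a : S) f : P := fun i => a *: f i.

Fact product_addA : associative add.
Proof. by move=> f g h; apply: functional_extensionality_dep => i; apply: addrA. Qed.
Fact product_addC : commutative add.
Proof. by move=> f g; apply: functional_extensionality_dep => i; apply: addrC. Qed.
Fact product_add0 : left_id zero add.
Proof. by move=> f; apply: functional_extensionality_dep => i; apply: add0r. Qed.
Fact product_addN : left_inverse zero opp add.
Proof. by move=> f; apply: functional_extensionality_dep => i; apply: addNr. Qed.
HB.instance Definition _ :=
  GRing.isZmodule.Build P product_addA product_addC product_add0 product_addN.

Fact product_scaleA a b f : scale a (scale b f) = scale (a * b) f.
Proof. by apply: functional_extensionality_dep => i; apply: scalerA. Qed.
Fact product_scale1 : left_id 1 scale.
Proof. by move=> f; apply: functional_extensionality_dep => i; apply: scale1r. Qed.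
Fact product_scaleDr : right_distributive scale +%R.
Proof. by move=> a f g; apply: functional_extensionality_dep => i; apply: scalerDr. Qed.
Fact product_scaleDl f : {morph scale^~ f : a b / a + b}.
Proof. by move=> a b; apply: functional_extensionality_dep => i; apply: scalerDl. Qed.
HB.instance Definition _ := GRing.Zmodule_isLmodule.Build S P
  product_scaleA product_scale1 product_scaleDr product_scaleDl.
End ProductModule.

(** * Linear maps and finite free modules *)

Lemma linearP_pack (S : pzRingType) (A B : lmodType S) (f : A -> B) :
  linear f -> exists g : {linear A -> B}, g =1 f.
Proof.
move=> fL; pose m := GRing.isLinear.Build S A B *:%R f fL.
by exists (HB.pack f m : {linear A -> B}).
Qed.

Lemma exists_linear (S : pzRingType) (A B : lmodType S) (f : A -> B) :
  linear f -> exists g : {linear A -> B}, g =1 f.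
Proof.
move=> fL; pose m := GRing.isLinear.Build S A B *:%R f fL.
by exists (HB.pack f m : {linear A -> B}).
Qed.

(** Preimages under an injective map are unique, so choosing them is automatically linear. With
    exactness, this lifts maps into a kernel. *)
Lemma linear_corestrict (S : pzRingType) (A B C : lmodType S)
    (i : {linear A -> B}) (f : {linear C -> B}) :
  injective i -> (forall x, exists y, i y = f x) ->
  exists g : {linear C -> A}, forall x, i (g x) = f x.
Proof.
move=> i_inj /choice[g ig].
have gL : linear g by move=> a x y; apply: i_inj; rewrite linearP !ig linearP.
by have [g' g'E] := exists_linear gL; exists g' => x; rewrite g'E.
Qed.

Lemma exists_linear_rV (S : pzRingType) n (M : lmodType S) (y : 'I_n -> M) :
  exists h : {linear 'rV[S]_n -> M}, forall c, h c = \sum_i c 0 i *: y i.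
Proof.
apply: exists_linear => a c d; rewrite scaler_sumr -big_split /=.
by apply: eq_bigr => i _; rewrite !mxE scalerDl scalerA.
Qed.

Lemma linear_rV_ext (S : pzRingType) n (M : lmodType S)
    (f g : {linear 'rV[S]_n -> M}) :
  (forall i, f (delta_mx 0 i) = g (delta_mx 0 i)) -> f =1 g.
Proof.
move=> fg c; rewrite [c]row_sum_delta !linear_sum; apply: eq_bigr => i _.
by rewrite !linearZ fg.
Qed.

Lemma projective_rV (S : pzRingType) n : projective ('rV[S]_n : lmodType S).
Proof.
move=> A B g f g_surj.
have [y gy] := choice (fun i => g_surj (f (delta_mx 0 i))).
have [h hE] := exists_linear_rV y.
exists h; apply: (@linear_rV_ext _ _ _ (g \o h) f) => i /=.
rewrite hE (bigD1 i) //= mxE !eqxx scale1r big1 ?addr0 // => k ki.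
by rewrite mxE (negPf ki) andbF scale0r.
Qed.

(** Taking coordinates embeds the tensor product of R^n with A into A^n, naturally in A. Tensoring
    with [f] thus becomes applying [f] in each coordinate, which is injective. *)
Lemma flat_rV (R : pzRingType) n : flat ('rV[R^c]_n : rmodType R).
Proof.
pose M : rmodType R := 'rV[R^c]_n.
pose coords (A : lmodType R) (m : M) (a : A) : {ffun 'I_n -> A} :=
  [ffun i => (m 0 i : R) *: a].
have coords_balanced A : balanced (@coords A).
  split=> [m m' a|m a a'|m r a]; apply/ffunP => i; rewrite !ffunE.
  - by rewrite mxE scalerDl.
  - by rewrite scalerDr.
  - by rewrite mxE scalerA.
have liftB A : zmod_morphism (tensor_lift (@coords A)).
  exact: tensor_lift_additive.
pose lift A : {additive tensor M A -> {ffun 'I_n -> A}} :=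
  HB.pack (tensor_lift (@coords A))
    (GRing.isZmodMorphism.Build _ _ (tensor_lift (@coords A)) (@liftB A)).
have lift_inj A : injective (lift A).
  have [tDl tDr tM] := @tens_balanced R M A.
  (* A left inverse of the coordinate map, checked on pure tensors by expanding [m] in the standard
     basis. *)
  pose s (v : {ffun 'I_n -> A}) : tensor M A :=
    \sum_i tens (delta_mx 0 i : M) (v i).
  have sB : zmod_morphism s.
    move=> v w; rewrite /s -sumrB; apply: eq_bigr => i _.
    by apply/eqP; rewrite eq_sym subr_eq -tDr !ffunE subrK.
  pose s' : {additive {ffun 'I_n -> A} -> tensor M A} :=
    HB.pack s (GRing.isZmodMorphism.Build _ _ s sB).
  apply: (can_inj (g := s')).
  apply: (@tensor_ext R M A _ (s' \o lift A) idfun) => m a /=.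
  rewrite tensor_liftE // /s.
  have t0 : tens (0 : M) a = 0.
    by apply: (addrI (tens (0 : M) a)); rewrite -tDl !addr0.
  have tsum := big_morph (fun m : M => tens m a) (fun x y => tDl x y a) t0.
  rewrite [in RHS](row_sum_delta m) tsum; apply: eq_bigr => i _.
  by rewrite ffunE -tM.
move=> A B f f_inj.
have fb : balanced (fun (m : M) a => tens m (f a)).
  have [tDl tDr tM] := @tens_balanced R M B.
  by split=> [m m' a|m a a'|m r a]; rewrite ?linearD ?linearZ.
have fB : zmod_morphism (tensor_map (M := M) f).
  exact: tensor_lift_additive.
pose f' : {additive tensor M A -> tensor M B} :=
  HB.pack (tensor_map (M := M) f)
    (GRing.isZmodMorphism.Build _ _ (tensor_map (M := M) f) fB).
pose Ff (v : {ffun 'I_n -> A}) : {ffun 'I_n -> B} := [ffun i => f (v i)].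
have FfB : zmod_morphism Ff.
  by move=> v w; apply/ffunP => i; rewrite !ffunE linearB.
pose Ff' : {additive {ffun 'I_n -> A} -> {ffun 'I_n -> B}} :=
  HB.pack Ff (GRing.isZmodMorphism.Build _ _ Ff FfB).
have natural : lift B \o f' =1 Ff' \o lift A.
  apply: (@tensor_ext R M A) => m a /=.
  rewrite /tensor_map !tensor_liftE //; apply/ffunP => i.
  by rewrite !ffunE linearZ.
have Ff_inj : injective Ff.
  by move=> v w /ffunP vw; apply/ffunP => i; apply: f_inj; have:= vw i; rewrite !ffunE.
move=> t t' tt'; apply/lift_inj/Ff_inj.
by rewrite -[LHS]natural -[RHS]natural /= tt'.
Qed.

(** * Elements of a direct limit *)

Section DirectLimit.
Variables (S : pzRingType) (D : direct_system S) (L : lmodType S).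
Variable phi : forall i : ds_index D, {linear ds_obj i -> L}.
Hypothesis limL : is_direct_limit phi.

Let directed := @ds_directed S D.

Lemma directed_ord n (f : 'I_n -> ds_index D) :
  exists k, forall t, (f t <= k)%O.
Proof.
elim: n f => [|n IHn] f.
  by case: (@ds_nonempty S D) => k; exists k => -[].
have [k kP] := IHn (fun t => f (lift ord0 t)).
have [l [kl fl]] := directed k (f ord0).
by exists l => t; case: (unliftP ord0 t) => [s|] -> //; apply: Order.le_trans kl.
Qed.

(** By directedness the images of the [phi i] form a submodule. The projection of [L] modulo it and
    the zero map both extend the zero cocone, so they agree by uniqueness. *)
Lemma direct_limit_surj x : exists i y, phi i y = x.
Proof.
pose U x := exists i y, phi i y = x.
have [coc univ] := limL.
have sub_U : submodule U.
  split=> [|a _ _ [i [y <-]] [j [z <-]]].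
    by case: (@ds_nonempty S D) => i; exists i, 0; rewrite linear0.
  have [k [ik jk]] := directed i j.
  by exists k, (a *: ds_map ik y + ds_map jk z); rewrite linearP !coc.
pose p : {linear L -> quotient_module sub_U} := @quotient_proj _ _ _ sub_U.
pose z : {linear L -> quotient_module sub_U} := \0.
pose zi (i : ds_index D) : {linear ds_obj i -> quotient_module sub_U} := \0.
have zi_coc : cocone zi by [].
have [h [_ h_uniq]] := univ _ zi zi_coc.
apply/(quotient_proj_eq0 sub_U).
apply: (etrans (h_uniq p _ x)) (esym (h_uniq z _ x)) => // i y.
by apply/(quotient_proj_eq0 sub_U); exists i, y.
Qed.

(* The colimit embeds in the product of the system modulo eventually zero
   families, by sending [x] in the [i]th object to the family of its images. *)
Lemma direct_limit_ker i x :
  phi i x = 0 -> exists k (ik : (i <= k)%O), ds_map ik x = 0.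
Proof.
pose V := product_module (@ds_obj S D).
pose U (f : V) := exists k, forall l, (k <= l)%O -> f l = 0.
have [coc univ] := limL.
have sub_U : submodule U.
  split=> [|a f g [j fj] [k gk]].
    by case: (@ds_nonempty S D) => j; exists j.
  have [l [jl kl]] := directed j k; exists l => m lm.
  rewrite -[LHS]/(a *: f m + g m) fj ?gk ?scaler0 ?addr0 //;
    exact: Order.le_trans lm.
(* The transition map needs a proof of [j <= k], hence the match. The default 0 at other indices
   does no harm, as only a tail of the family matters modulo [U]. *)
pose family (j : ds_index D) (y : ds_obj j) : V := fun k =>
  if @idP (j <= k)%O is ReflectT jk then ds_map jk y else 0.
have familyE j y k (jk : (j <= k)%O) : family j y k = ds_map jk y.
  rewrite /family; case: {-}_ / idP => // jk'.
  by rewrite (bool_irrelevance jk' jk).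
have psiL j : linear (fun y => quotient_proj sub_U (family j y)).
  move=> a y z; rewrite -linearP; congr quotient_proj.
  apply: functional_extensionality_dep => k; rewrite -[RHS]/(a *: _ + _) /family.
  by case: {-}_ / idP => [jk|_]; rewrite ?linearP // scaler0 addr0.
have [psi psiE] := all_tag (fun j => cid (exists_linear (psiL j))).
have psi_coc : cocone psi.
  move=> j k jk y; rewrite !psiE; apply/quotient_projP; exists k => l kl.
  have jl := Order.le_trans jk kl.
  rewrite -[LHS]/(family _ _ l - family _ _ l) (familyE _ _ _ kl) (familyE _ _ _ jl).
  by rewrite (ds_map_comp jk kl jl) subrr.
have [h [hE _]] := univ _ psi psi_coc.
move=> phix0; have := hE i x; rewrite phix0 linear0 psiE.
move/esym/quotient_proj_eq0 => [k famk].
have [l [il kl]] := directed i k.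
by exists l, il; rewrite -familyE famk.
Qed.

End DirectLimit.

(** * Finitely generated modules: presentations, embeddings, lifts to a stage of a direct limit *)

(** The kernel of [g] is the image of the idempotent id - s g, so the same R^k also serves for the
    relations. *)
Lemma projective_fp (S : pzRingType) k (N : lmodType S)
    (g : {linear 'rV[S]_k -> N}) (s : {linear N -> 'rV[S]_k}) :
  cancel s g -> finitely_presented N.
Proof.
move=> sK; exists k, k, (idfun \- (s \o g)), g.
split=> [x|x]; last by exists (s x).
split=> [gx0|[y <-]] /=; first by exists x; rewrite /= gx0 linear0 subr0.
by rewrite linearB /= sK subrr.
Qed.

Lemma fg_rV (S : pzRingType) (N : lmodType S) : finitely_generated N ->
  exists k (g : {linear 'rV[S]_k -> N}), surjective g.
Proof.
case=> k [g gN]; have [h hE] := exists_linear_rV g.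
exists k, h => x; have [c ->] := gN x; exists (\row_i c i).
by rewrite hE; apply: eq_bigr => i _; rewrite mxE.
Qed.

(** Finitely many generators involve only finitely many basis elements, and these span a finite free
    submodule containing the image of [v]. *)
Lemma fg_sub_free_rV (S : pzRingType) (F N : lmodType S) (v : {linear N -> F}) :
  free_module F -> injective v -> finitely_generated N ->
  exists n (j : {linear N -> 'rV[S]_n}), injective j.
Proof.
case=> I [e [e_free e_span]] v_inj /fg_rV[k [g g_surj]].
have /choice[s sP] (i : 'I_k) : exists s, exists c,
  v (g (delta_mx 0 i)) = \sum_(t <- s) c t *: e t by exact: e_span.
pose T := undup (flatten [seq s i | i : 'I_k]).
have [u uE] := exists_linear_rV (fun t : 'I_(size T) => e (tnth (in_tuple T) t)).
(* The list [s i] may repeat a basis index; induction on it adds up the coefficients. *)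
have sub_s i c : exists y, u y = \sum_(t <- s i) c t *: e t.
  suff: {subset s i <= T}.
    elim: (s i) => [|t l IHl] lT.
      by exists 0; rewrite linear0 big_nil.
    have [z zE] : exists z, u z = \sum_(t <- l) c t *: e t.
      by apply: IHl => t' t'l; apply: lT; rewrite inE t'l orbT.
    have /seq_tnthP[q tq] : t \in T by apply: lT; rewrite mem_head.
    exists (c t *: delta_mx 0 q + z); rewrite linearP zE big_cons; congr (_ *: _ + _).
    rewrite (uE (delta_mx 0 q)) (bigD1 q) //= mxE !eqxx scale1r big1 ?addr0 -?tq // => r rq.
    by rewrite mxE (negPf rq) andbF scale0r.
  move=> t ts; rewrite mem_undup; apply/flattenP; exists (s i) => //.
  exact: image_f.
have u_inj : injective u.
  apply: raddf_inj => y /(etrans (esym (uE y))) y0.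
  (* Turns a coordinate vector into coefficients indexed by [I], as [basis] requires; the default 0
     is only taken outside [T]. *)
  pose c t : S := if insub (index t T) is Some q then y 0 q else 0.
  have cE q : c (tnth (in_tuple T) q) = y 0 q.
    rewrite /c (tnth_nth (tnth (in_tuple T) q)) index_uniq ?undup_uniq //.
    by rewrite valK.
  have c0 : \sum_(t <- T) c t *: e t = 0.
    rewrite big_tnth -[RHS]y0; apply: eq_bigr => q _.
    by rewrite cE.
  apply/rowP => q; rewrite mxE -cE; apply: (e_free T) => //.
    exact: undup_uniq.
  by rewrite mem_tnth.
have vu x : exists y, u y = v x.
  have [a <-] := g_surj x.
  have /choice[y yE] i : exists y, u y = v (g (delta_mx 0 i)).
    by have [c ->] := sP i; apply: sub_s.
  exists (\sum_i a 0 i *: y i).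
  rewrite [a in RHS]row_sum_delta !linear_sum; apply: eq_bigr => i _.
  by rewrite !linearZ yE.
have [j jE] := linear_corestrict u_inj vu.
exists (size T), j => x x' jx; apply: v_inj.
by rewrite -[LHS]jE jx jE.
Qed.

(* Factoring [p] through one [M_k] modulo the finitely many generators of the
   kernel makes the finitely presented cokernel of [j] a retract of [M_k]. *)
Lemma direct_limit_lift (S : pzRingType) (D : direct_system S) (L N : lmodType S)
    (phi : forall i : ds_index D, {linear ds_obj i -> L}) n
    (j : {linear N -> 'rV[S]_n}) (p : {linear 'rV[S]_n -> L}) :
  is_direct_limit phi -> finitely_generated N -> (forall x, p (j x) = 0) ->
  exists k (h : {linear 'rV[S]_n -> ds_obj k}),
    (forall x, phi k (h x) = p x) /\ forall x, h (j x) = 0.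
Proof.
move=> limL /fg_rV[m [g g_surj]] pj; have [coc _] := limL.
have lift1 t := cid (direct_limit_surj limL (p (delta_mx 0 t))).
have lift2 t := cid (projT2 (lift1 t)).
have [i iP] := directed_ord (fun t => projT1 (lift1 t)).
have [h0 h0E] := exists_linear_rV (fun t => ds_map (iP t) (projT1 (lift2 t))).
have h0P : phi i \o h0 =1 p.
  apply: linear_rV_ext => t /=; rewrite h0E (bigD1 t) //=.
  rewrite mxE !eqxx scale1r big1 ?addr0 => [|q qt].
    by rewrite coc (projT2 (lift2 t)).
  by rewrite mxE (negPf qt) andbF scale0r.
(* Each generator of the kernel goes to 0 in [L], so its image under [h0] dies at some later
   stage. *)
have ker1 t : exists k (ik : (i <= k)%O), ds_map ik (h0 (j (g (delta_mx 0 t)))) = 0.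
  by apply: (direct_limit_ker limL); rewrite -[LHS]/((phi i \o h0) _) h0P.
have {}ker1 t := cid (ker1 t).
have [l lP] := directed_ord (fun t => projT1 (ker1 t)).
have [k [ik lk]] := ds_directed i l.
exists k, (ds_map ik \o h0); split=> [x|x] /=; first by rewrite coc -h0P.
have [a <-] := g_surj x.
apply: (linear_rV_ext (f := ds_map ik \o h0 \o j \o g) (g := \0)) a => t /=.
have [ikt zt] := projT2 (ker1 t).
have tk := Order.le_trans (lP t) lk.
by rewrite (ds_map_comp ikt tk ik) zt linear0.
Qed.

(** * Comparison of resolutions and coherence *)

Lemma fp_of_flat_fg_sub_rV (R : pzRingType)
  (limP1_eq_F1 : forall M : rmodType R,
     direct_limits (@class_P1 R) M <-> class_F1 M)
  (N : rmodType R) n (j : {linear N -> 'rV[R^c]_n}) :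
  injective j -> finitely_generated N -> flat N -> finitely_presented N.
Proof.
move=> j_inj N_fg N_flat.
have sub_jN : submodule (fun x => exists y, j y = x).
  split=> [|a _ _ [y <-] [z <-]]; first by exists 0; rewrite linear0.
  by exists (a *: y + z); rewrite linearP.
pose M := quotient_module sub_jN.
pose p : {linear 'rV[R^c]_n -> M} := @quotient_proj _ _ _ sub_jN.
have p_surj : surjective p := @quotient_proj_surj _ _ _ sub_jN.
have pP x : p x = 0 <-> exists y, j y = x := @quotient_proj_eq0 _ _ _ sub_jN x.
have M_F1 : class_F1 (M : rmodType R).
  by exists N, 'rV[R^c]_n, j, p; split=> //; exact: flat_rV.
have [D [phi [D_P1 limM]]] := (limP1_eq_F1 M).2 M_F1.
have pj x : p (j x) = 0 by apply/pP; exists x.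
have [k [h [phih hj]]] := direct_limit_lift limM N_fg pj.
have [Q1 [Q0 [i [q [Q1_proj Q0_proj i_inj iqP q_surj]]]]] := D_P1 k.
have qi y : q (i y) = 0 by apply/iqP; exists y.
(* [a] and [c] are the degree 0 parts of the lifts of M -> M_k and M_k -> M, [b]
   and [d] their degree 1 parts, and [e] is the homotopy. *)
have [a aE] := projective_rV h q_surj.
have [b bE] : exists b : {linear N -> Q1}, forall x, i (b x) = (a \o j) x.
  by apply: linear_corestrict => // x; apply/iqP; rewrite /= aE hj.
have [c cE] := Q0_proj _ _ p (phi k \o q) p_surj.
have [d dE] : exists d : {linear Q1 -> N}, forall x, j (d x) = (c \o i) x.
  by apply: linear_corestrict => // x; apply/pP; rewrite /= cE /= qi linear0.
(* The map c a - id lands in the kernel of [p] because p c a = phi_k q a = phi_k h = p. *)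
have [e eE] : exists e : {linear 'rV[R^c]_n -> N},
    forall x, j (e x) = ((c \o a) \- idfun) x.
  apply: linear_corestrict => // x; apply/pP.
  by rewrite linearB /= cE /= aE phih subrr.
have [m [g g_surj]] := fg_rV N_fg.
(* Lifting [d] and [e] through [g] makes [N] a retract of the finite free module R^m itself, as
   [projective_fp] needs. *)
have [d' d'E] := Q1_proj _ _ g d g_surj.
have [e' e'E] := projective_rV e g_surj.
apply: (projective_fp (g := g) (s := (d' \o b) \- (e' \o j))) => x /=.
(* After composing with [j], the identity to check is c a j - (c a - id) j = j. *)
apply: j_inj; rewrite linearB /= d'E e'E linearB dE eE /= bE /=.
by rewrite opprB addrC subrK.
Qed.

Theorem corollary3p9 (R : pzRingType)
  (limP1_eq_F1 : forall M : rmodType R,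
     direct_limits (@class_P1 R) M <-> class_F1 M) :
  right_F1fp_coherent R.
Proof.
move=> F P N F_free N_fg N_flat.
have [n [j j_inj]] :=
  fg_sub_free_rV (v := (\val : {linear N -> F})) F_free val_inj N_fg.
exact: (fp_of_flat_fg_sub_rV limP1_eq_F1 j_inj).
Qed.
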